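(* Let $a,b,t$ be complex numbers, let $f_3(z,a,b)$ be the unique formal power series with $f_3=1+azf_3+bz^3f_3^2$, define $C(n,3,a,b,t)$ by $\sum_{n\ge0}C(n,3,a,b,t)z^n=\frac{f_3}{1-tzf_3}$, and let $D_1^{(3)}(N,a,b,t)=\det\big(C(i+j+1,3,a,b,t)\big)_{i,j=0}^{N-1}$. Then $$D_1^{(3)}(3n,a,b,t)=(-1)^nb^{3n^2}\ (n\ge0),\qquad D_1^{(3)}(3n+1,a,b,t)=(-1)^n\big((n+1)a+t\big)b^{3n^2+2n}\ (n\ge0),$$ $$D_1^{(3)}(3n-1,a,b,t)=(-1)^{n-1}(na+t)b^{3n^2-2n}\ (n\ge1).$$
   Context: The determinant of a $0\times0$ matrix is $1$. *)

(* Defs.v *)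
From HB Require Import structures.
From mathcomp Require Import all_boot all_order all_algebra.
From mathcomp Require Import complex.
From mathcomp Require Import boolp classical_sets reals.

Set Implicit Arguments.
Unset Strict Implicit.
Unset Printing Implicit Defensive.

Import GRing.Theory.
Local Open Scope ring_scope.

(* Formal power series, given by their coefficient sequences. The record keeps
   the Cauchy product apart from the pointwise ring structure on functions. *)
Record fps (K : Type) := Fps { coefs :> nat -> K }.

Lemma fpsP (K : Type) (u v : fps K) : (forall n, u n = v n) <-> u = v.
Proof.
split=> [|-> //]; case: u => u; case: v => v /= e.
by congr Fps; apply/funext.
Qed.

HB.instance Definition _ (K : Type) := gen_eqMixin (fps K).
HB.instance Definition _ (K : Type) := gen_choiceMixin (fps K).

Section FpsRing.
Variable K : fieldType.
Implicit Types u v w : fps K.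

Definition fps_zero : fps K := Fps (fun=> 0).
Definition fps_opp u : fps K := Fps (fun n => - u n).
Definition fps_add u v : fps K := Fps (fun n => u n + v n).

Fact fps_addA : associative fps_add.
Proof. by move=> u v w; apply/fpsP => n /=; rewrite addrA. Qed.
Fact fps_addC : commutative fps_add.
Proof. by move=> u v; apply/fpsP => n /=; rewrite addrC. Qed.
Fact fps_add0 : left_id fps_zero fps_add.
Proof. by move=> u; apply/fpsP => n /=; rewrite add0r. Qed.
Fact fps_addN : left_inverse fps_zero fps_opp fps_add.
Proof. by move=> u; apply/fpsP => n /=; rewrite addNr. Qed.

HB.instance Definition _ := GRing.isZmodule.Build (fps K)
  fps_addA fps_addC fps_add0 fps_addN.

Definition fpsC (c : K) : fps K := Fps (fun n => if n == 0%N then c else 0).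
Definition fpsX : fps K := Fps (fun n => (n == 1%N)%:R).
Definition fps_mul u v : fps K :=
  Fps (fun n => \sum_(i < n.+1) u i * v (n - i)%N).

Definition fps_trunc m u : {poly K} := \poly_(i < m) u i.

Lemma fps_mul_trunc m u v n : (n < m)%N ->
  fps_mul u v n = (fps_trunc m u * fps_trunc m v)`_n.
Proof.
move=> lt_nm; rewrite coefM /=; apply: eq_bigr => i _; rewrite !coef_poly.
by rewrite (leq_trans (ltn_ord i) lt_nm) (leq_ltn_trans (leq_subr _ _) lt_nm).
Qed.

Fact fps_mulC : commutative fps_mul.
Proof. by move=> u v; apply/fpsP => n; rewrite !(fps_mul_trunc _ _ (ltnSn n)) mulrC. Qed.

Fact fps_mulA : associative fps_mul.
Proof.
move=> u v w; apply/fpsP => n.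
transitivity ((fps_trunc n.+1 u * (fps_trunc n.+1 v * fps_trunc n.+1 w))`_n).
  rewrite coefM; apply: eq_bigr => i _.
  rewrite -fps_mul_trunc ?ltnS ?leq_subr //.
  by rewrite coef_poly ltn_ord.
rewrite mulrA coefM; apply: eq_bigr => i _.
rewrite -fps_mul_trunc ?ltn_ord //.
by rewrite coef_poly ltnS leq_subr.
Qed.

Fact fps_mul1 : left_id (fpsC 1) fps_mul.
Proof.
move=> u; apply/fpsP => n /=; rewrite big_ord_recl /= mul1r subn0.
by rewrite big1 ?addr0 // => i _; rewrite mul0r.
Qed.

Fact fps_mulDl : left_distributive fps_mul +%R.
Proof.
move=> u v w; apply/fpsP => n /=; rewrite -big_split /=.
by apply: eq_bigr => i _; rewrite mulrDl.
Qed.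

Fact fps_1neq0 : fpsC 1 != 0.
Proof. by apply/eqP => /fpsP /(_ 0%N) /= /eqP; rewrite oner_eq0. Qed.

HB.instance Definition _ := GRing.Zmodule_isComNzRing.Build (fps K)
  fps_mulA fps_mulC fps_mul1 fps_mulDl fps_1neq0.

(* The sequence whose n-th term is F applied to the list of its first n terms. *)
Fixpoint fps_prefix (F : seq K -> K) n : seq K :=
  if n is m.+1 then rcons (fps_prefix F m) (F (fps_prefix F m)) else [::].
Definition fps_rec (F : seq K -> K) : fps K := Fps (fun n => F (fps_prefix F n)).

Lemma fps_recE F n : fps_rec F n = F (mkseq (fps_rec F) n).
Proof.
rewrite /=; congr F; elim: n => //= n IHn.
by rewrite {1}IHn /mkseq -[in RHS]addn1 iotaD map_cat /= cats1.
Qed.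

(* For u 0 != 0, solves u * v = 1 coefficientwise; otherwise returns u, as the
   library requires of inverses of non-units. *)
Definition fps_inv u : fps K :=
  if u 0%N == 0 then u else
  fps_rec (fun s => (u 0%N)^-1 *
    ((size s == 0%N)%:R - \sum_(i < size s) u i.+1 * nth 0 s (size s - i.+1))).

Definition fps_unit : {pred fps K} := fun u => u 0%N != 0.

Fact fps_mulV : {in fps_unit, left_inverse 1 fps_inv *%R}.
Proof.
move=> u; rewrite unfold_in /fps_unit => u0.
rewrite mulrC; apply/fpsP => n; rewrite /fps_inv (negPf u0).
set v := fps_rec _.
change (\sum_(i < n.+1) u i * v (n - i)%N = if n == 0%N then 1 else 0).
rewrite big_ord_recl subn0.
have -> : v n = (u 0%N)^-1 * ((n == 0%N)%:R - \sum_(i < n) u i.+1 * v (n - i.+1)%N).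
  rewrite {1}/v fps_recE -/v size_mkseq; congr (_ * (_ - _)).
  apply: eq_bigr => i _; rewrite nth_mkseq //.
  by rewrite ltn_subrL /= (leq_ltn_trans _ (ltn_ord i)).
rewrite mulrA mulfV // mul1r.
by rewrite subrK; case: (n == 0%N).
Qed.

Fact fps_unitPl u v : v * u = 1 -> fps_unit u.
Proof.
move=> /fpsP /(_ 0%N).
change (\sum_(i < 1) v i * u (0 - i)%N = 1 -> fps_unit u).
rewrite big_ord1 subn0 /fps_unit => e; apply/eqP => u0.
by move/eqP: e; rewrite u0 mulr0 eq_sym oner_eq0.
Qed.

Fact fps_inv_out : {in [predC fps_unit], fps_inv =1 id}.
Proof.
by move=> u; rewrite inE /= unfold_in /fps_unit negbK /fps_inv => ->.
Qed.

HB.instance Definition _ := GRing.ComNzRing_hasMulInverse.Build (fps K)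
  fps_mulV fps_unitPl fps_inv_out.

Lemma coef_fpsD u v n : (u + v) n = u n + v n. Proof. by []. Qed.
Lemma coef_fpsN u n : (- u) n = - u n. Proof. by []. Qed.
Lemma coef_fps1 n : (1 : fps K) n = (n == 0%N)%:R.
Proof. by case: n. Qed.
Lemma coef_fpsM u v n : (u * v) n = \sum_(i < n.+1) u i * v (n - i)%N.
Proof. by []. Qed.

Lemma coef_fpsCM c u n : (fpsC c * u) n = c * u n.
Proof.
rewrite coef_fpsM big_ord_recl subn0 big1 ?addr0 // => i _.
by rewrite /= mul0r.
Qed.

Lemma coef_fpsXM u n : (fpsX * u) n = if n is m.+1 then u m else 0.
Proof.
rewrite coef_fpsM big_ord_recl /= mul0r add0r.
case: n => [|n]; first by rewrite big_ord0.
rewrite big_ord_recl /= mul1r subn1 big1 ?addr0 // => i _.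
by rewrite mul0r.
Qed.

End FpsRing.

Arguments fpsX {K}.

Section Cseq.
Variable K : fieldType.
Implicit Types (a b t : K) (f : fps K).

Definition f3_eqn a b f : Prop :=
  f = 1 + fpsC a * fpsX * f + fpsC b * fpsX ^+ 3 * f ^+ 2.

Let rhs a b (s : seq K) : K :=
  let n := size s in
  (n == 0%N)%:R + a * (if n is m.+1 then nth 0 s m else 0)
  + b * (if n is m.+3 then \sum_(i < m.+1) nth 0 s i * nth 0 s (m - i) else 0).

Let f3_eqnE a b f : f3_eqn a b f <-> forall n, f n = rhs a b (mkseq f n).
Proof.
suff e n : (1 + fpsC a * fpsX * f + fpsC b * fpsX ^+ 3 * f ^+ 2) n
           = rhs a b (mkseq f n).
  split=> [E n|E]; first by rewrite {1}E e.
  by apply/fpsP => n; rewrite e -E.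
rewrite !coef_fpsD -!mulrA !coef_fpsCM coef_fpsXM coef_fps1 /rhs size_mkseq.
congr (_ + _ * _ + _ * _).
  by case: n => // n; rewrite nth_mkseq.
rewrite coef_fpsXM.
case: n => // n; rewrite coef_fpsXM; case: n => // n; rewrite coef_fpsXM.
case: n => // n; rewrite coef_fpsM; apply: eq_bigr => i _.
rewrite !nth_mkseq //.
  by rewrite (leq_ltn_trans (leq_subr _ _)) // ltnS leqW.
by rewrite (leq_trans (ltn_ord i)) // ltnS leqW.
Qed.

Lemma f3_exists_unique a b : exists! f, f3_eqn a b f.
Proof.
exists (fps_rec (rhs a b)); split; first by apply/f3_eqnE => n; rewrite fps_recE.
move=> g /f3_eqnE gE; apply/fpsP => n; elim/ltn_ind: n => n IHn.
rewrite gE fps_recE; congr rhs; apply: (@eq_from_nth _ 0); rewrite !size_mkseq //.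
by move=> i ltin; rewrite !nth_mkseq // IHn.
Qed.

Definition f3 a b : fps K := xget 0 [set f | f3_eqn a b f].

Lemma f3P a b : f3_eqn a b (f3 a b).
Proof.
by have [f [fE _]] := f3_exists_unique a b; exact: (xgetI 0 (P := [set f | f3_eqn a b f]) fE).
Qed.

Lemma f3_unique a b f : f3_eqn a b f -> f = f3 a b.
Proof.
have [g [_ gU]] := f3_exists_unique a b.
by move=> /gU <-; apply: gU; apply: f3P.
Qed.

Definition C3_gf a b t : fps K := f3 a b / (1 - fpsC t * fpsX * f3 a b).

Lemma C3_gf_den_unit a b t : 1 - fpsC t * fpsX * f3 a b \is a GRing.unit.
Proof.
rewrite unfold_in /= /fps_unit coef_fpsD coef_fpsN coef_fps1 -mulrA.
by rewrite coef_fpsCM coef_fpsXM mulr0 subr0 oner_neq0.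
Qed.

Definition C3 (n : nat) a b t : K := C3_gf a b t n.

Definition D1_3 (N : nat) a b t : K :=
  \det (\matrix_(i < N, j < N) C3 (i + j + 1) a b t).

End Cseq.

(* Main.v *)
Require Import Defs.
From HB Require Import structures.
From mathcomp Require Import all_boot all_order all_algebra.
From mathcomp Require Import complex reals.
From mathcomp Require Import zify ring.
Set Implicit Arguments.
Unset Strict Implicit.
Unset Printing Implicit Defensive.

Import GRing.Theory.
Local Open Scope ring_scope.

(** Write H(u) for the Hankel matrix (u_(i+j+1)) and L(u) for the lower
    triangular Toeplitz matrix of a power series u. The difference quotient
    (u(x) - u(y)) / (x - y) obeys the Leibniz rule, which for matrices reads
    H(uv) = L(u) H(v) + H(u) L(v)^T. Applied to F = f / (1 - t z f) and its
    inverse 1/F = 1 - (a + t) z - b z^3 f, it shows that det H(F) is the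
    determinant of M(a + t), where M(s) = s E_00 + b H(z^3 f). Conjugating M(s)
    by L(1/f) and clearing one block yields a 3x3 block of determinant -b^3 and
    the block b^2 L(f) M(s + a) L(f)^T, so
    D(N + 3, t) = - b^(2N+3) D(N, t + a). *)

(** * Hankel and Toeplitz matrices of power series *)

Section Hankel.
Variable K : fieldType.
Implicit Types (u v : fps K) (n : nat).

Definition hankel n u : 'M[K]_n := \matrix_(i, j) u (i + j + 1)%N.

(** Reading column j off [fpsX ^+ j * u] builds in the zeros above the diagonal and turns products
    of series into products of matrices. *)
Definition toeplitz n u : 'M[K]_n := \matrix_(i, j) (fpsX ^+ j * u) i.

Lemma coef_fpsXnM k u i :
  (fpsX ^+ k * u) i = if (k <= i)%N then u (i - k)%N else 0.
Proof.
elim: k i => [|k IHk] i; first by rewrite mul1r subn0.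
by rewrite exprS -mulrA coef_fpsXM; case: i => [|i] //; rewrite IHk subSS.
Qed.

Lemma coef_fpsXn k i : (fpsX ^+ k : fps K) i = (i == k)%:R.
Proof.
rewrite -[fpsX ^+ k]mulr1 coef_fpsXnM coef_fps1.
by rewrite subn_eq0 eqn_leq andbC; case: (k <= i)%N.
Qed.

Lemma sum_ord_le n (i : 'I_n) (F : nat -> K) :
  \sum_(k < n) (if (k <= i)%N then F k else 0) = \sum_(k < i.+1) F k.
Proof. by rewrite -big_mkcond /= (big_ord_narrow (ltn_ord i)). Qed.

(** By triangularity row i only meets indices k <= i, so a column of coefficients of G yields a
    Cauchy product, unaffected by truncation to size n. *)
Lemma toeplitz_mulE n u (A : 'M[K]_n) (G : nat -> K) (i j : 'I_n) :
  (forall k : 'I_n, A k j = G k) ->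
  (toeplitz n u *m A) i j = \sum_(k < i.+1) u (i - k)%N * G k.
Proof.
move=> AG; rewrite mxE -(@sum_ord_le _ _ (fun k => u (i - k)%N * G k)).
apply: eq_bigr => k _; rewrite mxE coef_fpsXnM AG.
by case: ifP => // _; rewrite mul0r.
Qed.

Lemma trmx_hankel n u : (hankel n u)^T = hankel n u.
Proof. by apply/matrixP => i j; rewrite !mxE [(j + i)%N]addnC. Qed.

Lemma toeplitzM n u v : toeplitz n (u * v) = toeplitz n u *m toeplitz n v.
Proof.
apply/matrixP => i j.
rewrite (@toeplitz_mulE _ _ _ (fpsX ^+ j * v)); last first.
  by move=> k; rewrite mxE.
rewrite mxE mulrCA mulrC coef_fpsM; apply: eq_bigr => k _.
by rewrite mulrC.
Qed.

Lemma toeplitz1 n : toeplitz n 1 = 1%:M.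
Proof. by apply/matrixP => i j; rewrite !mxE mulr1 coef_fpsXn. Qed.

Lemma det_toeplitz n u : \det (toeplitz n u) = u 0%N ^+ n.
Proof.
rewrite det_trig; last first.
  by apply/is_trig_mxP => i j ij; rewrite mxE coef_fpsXnM leqNgt ij.
under eq_bigr => i _ do rewrite mxE coef_fpsXnM leqnn subnn.
by rewrite prodr_const card_ord.
Qed.

(** The Cauchy sum of index i + j + 1 splits in two: terms with index of u at most i form the first
    product; in the others the index of v is at most j, and they form the second. *)
Lemma hankelM n u v :
  hankel n (u * v) = toeplitz n u *m hankel n v + hankel n u *m (toeplitz n v)^T.
Proof.
apply/matrixP => i j; rewrite [LHS]mxE [RHS]mxE.
have -> : (hankel n u *m (toeplitz n v)^T) i j
        = (toeplitz n v *m hankel n u) j i.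
  by rewrite -{1}(trmx_hankel n u) -trmx_mul mxE.
have -> := @toeplitz_mulE n u (hankel n v) (fun k => v (k + j + 1)%N) i j.
  have -> := @toeplitz_mulE n v (hankel n u) (fun k => u (k + i + 1)%N) j i.
    have e : (i + j + 1).+1 = (i.+1 + j.+1)%N by lia.
    rewrite coef_fpsM e big_split_ord /=; congr (_ + _).
      rewrite (reindex_inj rev_ord_inj) /=; apply: eq_bigr => k _.
      by have := ltn_ord k => ki; congr (u _ * v _); lia.
    apply: eq_bigr => k _; have := ltn_ord k => kj.
    by rewrite mulrC; congr (v _ * u _); lia.
  by move=> k; rewrite mxE.
by move=> k; rewrite mxE.
Qed.

Lemma hankel1 n : hankel n 1 = 0.
Proof. by apply/matrixP => i j; rewrite !mxE coef_fps1 addn1. Qed.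

Lemma hankel_inv n u v : v * u = 1 ->
  hankel n u = toeplitz n u *m (- hankel n v) *m (toeplitz n u)^T.
Proof.
move=> vu1; have := hankelM n v u; rewrite vu1 hankel1 => /esym /eqP.
rewrite addr_eq0 => /eqP e.
have uv : toeplitz n u *m toeplitz n v = 1%:M.
  by rewrite -toeplitzM mulrC vu1 toeplitz1.
by rewrite -mulmxA mulNmx -e mulmxA uv mul1mx.
Qed.

Lemma det_hankel_inv n u v : u 0%N = 1 -> v * u = 1 ->
  \det (hankel n u) = \det (- hankel n v).
Proof.
move=> u0 vu1; rewrite (hankel_inv n vu1) !det_mulmx det_tr det_toeplitz u0.
by rewrite expr1n mul1r mulr1.
Qed.

(* The image in matrices of the constant bivariate series 1. *)
Definition corner n : 'M[K]_n := \matrix_(i, j) ((i + j)%N == 0%N)%:R.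

Lemma toeplitz_corner n u :
  toeplitz n u *m corner n *m (toeplitz n u)^T = \matrix_(i, j) (u i * u j).
Proof.
case: n => [|n]; first by apply/matrixP => -[].
have cE (k l : 'I_n.+1) : k != ord0 -> corner n.+1 l k = 0 /\ corner n.+1 k l = 0.
  move=> k0; rewrite !mxE !addn_eq0.
  by rewrite (negPf (k0 : k != 0%N :> nat)) andbF.
apply/matrixP => i j; rewrite [LHS]mxE [RHS]mxE (bigD1 ord0) // big1 => [|k /cE k0].
  rewrite [X in X * _]mxE (bigD1 ord0) // big1 => [|k /cE k0].
    by rewrite /= !addr0 !mxE !coef_fpsXnM !subn0 mulr1.
  by rewrite (k0 _).2 mulr0.
by rewrite [X in X * _]mxE big1 ?mul0r // => l _; rewrite (k0 _).1 mulr0.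
Qed.

End Hankel.

(** * The recursion from size n to size n + 3 *)

Section Recursion.
Variables (K : fieldType) (a b : K).
Let f := f3 a b.

Definition hmx n s : 'M[K]_n := s *: corner K n + b *: hankel n (fpsX ^+ 3 * f).

(** Dividing the equation of f by f gives 1/f = [f3V a]; subtracting t z then gives 1/F =
    [f3V (a + t)], so t only shifts s. *)
Definition f3V (s : K) : fps K := 1 - fpsC s * fpsX - fpsC b * (fpsX ^+ 3 * f).

Lemma f3VM : f3V a * f = 1.
Proof.
have := f3P a b; rewrite /f3_eqn -/f => fE; rewrite /f3V !mulrBl mul1r {1}fE.
ring.
Qed.

Lemma coef_f3V s k :
  f3V s k = (k == 0%N)%:R - s * (k == 1%N)%:R
            - b * (if (3 <= k)%N then f (k - 3)%N else 0).
Proof.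
by rewrite /f3V !coef_fpsD !coef_fpsN !coef_fpsCM coef_fpsXnM coef_fps1.
Qed.

Lemma f3_0 : f 0%N = 1.
Proof.
have /fpsP/(_ 0%N) := f3VM; rewrite coef_fpsM big_ord1 coef_f3V coef_fps1 /=.
by rewrite !mulr0 !subr0 mul1r.
Qed.

Lemma hankel_f3V n s : - hankel n (f3V s) = hmx n s.
Proof.
apply/matrixP => i j; rewrite !mxE coef_f3V coef_fpsXnM.
by rewrite !addn1 eqSS /=; ring.
Qed.

Lemma C3_gfVM t : f3V (a + t) * C3_gf a b t = 1.
Proof.
have du := C3_gf_den_unit a b t.
rewrite /C3_gf mulrA -/f in du *; apply: canLR (mulrK du) _; rewrite mul1r.
have fC : fpsC (a + t) = fpsC a + fpsC t.
  by apply/fpsP => n; rewrite coef_fpsD /=; case: ifP; rewrite ?addr0.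
rewrite -[in RHS]f3VM /f3V fC; ring.
Qed.

Lemma D1_3E n t : D1_3 n a b t = \det (hmx n (a + t)).
Proof.
rewrite -hankel_f3V -(det_hankel_inv _ _ (C3_gfVM t)) //.
have /fpsP/(_ 0%N) := C3_gfVM t; rewrite coef_fpsM big_ord1 coef_f3V coef_fps1 /=.
by rewrite !mulr0 !subr0 mul1r.
Qed.

Lemma hankel_f3 n : hankel n f = toeplitz n f *m hmx n a *m (toeplitz n f)^T.
Proof. by rewrite -hankel_f3V (hankel_inv n f3VM). Qed.

Let phi n : 'rV[K]_n := \row_j f j.
Let v3 : 'cV[K]_3 := \col_i f3V a i.
Let e3 : 'cV[K]_3 := \col_i (i == 2%N :> nat)%:R.
(** The upper left block of L(1/f) H(z^3 f) L(1/f)^T. *)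
Let K3 : 'M[K]_3 :=
  \matrix_(i, j) (if (2 <= i + j)%N then f3V a (i + j - 2)%N else 0).

(** The Leibniz rule for (1/f) (z^3 f) = z^3 writes L(1/f) H(z^3 f) L(1/f)^T as a term living on
    rows 0 to 2 minus a term living on columns from 3 on. They cancel in the upper right block. *)
Lemma hmx_conj n s :
  toeplitz (3 + n) (f3V a) *m hmx (3 + n) s *m (toeplitz (3 + n) (f3V a))^T =
  block_mx (s *: (v3 *m v3^T) + b *: K3) (- (s * b) *: (v3 *m phi n))
           (- (s * b) *: ((phi n)^T *m v3^T))
           (b ^+ 2 *: (s *: ((phi n)^T *m phi n) + hankel n f)).
Proof.
set m := (3 + n)%N; set L := toeplitz m (f3V a); set P := fpsX ^+ 3 * f.
have VP : f3V a * P = fpsX ^+ 3 by rewrite mulrCA f3VM mulr1.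
have PE : L *m hankel m P *m L^T =
    hankel m (fpsX ^+ 3) *m L^T - hankel m (f3V a) *m (toeplitz m (fpsX ^+ 3))^T.
  rewrite -{1}VP hankelM mulmxDl -/L -[_ *m (toeplitz m P)^T *m _]mulmxA.
  by rewrite -trmx_mul -toeplitzM VP addrK.
rewrite mulmxDr mulmxDl -!scalemxAr -!scalemxAl toeplitz_corner PE.
have HLE i j : (hankel m (fpsX ^+ 3) *m L^T) i j
    = if (i <= 2 <= i + j)%N then f3V a (i + j - 2)%N else 0.
  rewrite mxE; case: (leqP i 2) => i2 /=; last first.
    rewrite big1 // => k _; rewrite !mxE coef_fpsXn.
    by case: eqP => [|_]; [lia | rewrite mul0r].
  (* Row i of [hankel m (fpsX ^+ 3)] has its only nonzero entry at k = 2 - i. *)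
  have kP : (2 - i < m)%N by rewrite /m; lia.
  rewrite (bigD1 (Ordinal kP)) //= big1 => [|k /eqP kN].
    rewrite !mxE coef_fpsXn coef_fpsXnM /= addr0.
    have -> : ((i + (2 - i) + 1)%N == 3) by lia.
    by rewrite mul1r leq_subLR subnBA // [(j + i)%N]addnC.
  rewrite !mxE coef_fpsXn; case: eqP => [e|_]; last by rewrite mul0r.
  by case: kN; apply: val_inj => /=; lia.
have HXE i j : (hankel m (f3V a) *m (toeplitz m (fpsX ^+ 3))^T) i j
    = if (3 <= j)%N then f3V a (i + j - 2)%N else 0.
  rewrite mxE; case: (leqP 3 j) => j3; last first.
    rewrite big1 // => k _; rewrite !mxE -exprD coef_fpsXn.
    by case: eqP => [|_]; [lia | rewrite mulr0].
  have kP : (j - 3 < m)%N by rewrite (leq_ltn_trans (leq_subr _ _)).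
  rewrite (bigD1 (Ordinal kP)) //= big1 => [|k /eqP kN].
    rewrite !mxE -exprD coef_fpsXn /= addr0 subnK // eqxx mulr1.
    by rewrite (_ : (i + (j - 3) + 1 = i + j - 2)%N) //; lia.
  rewrite !mxE -exprD coef_fpsXn; case: eqP => [e|_]; last by rewrite mulr0.
  by case: kN; apply: val_inj => /=; lia.
(* From index 3 on, 1/f is - b z^3 f; this brings f back into the blocks. *)
have V3 k : f3V a (3 + k)%N = - (b * f k).
  by rewrite coef_f3V addKn -[(3 + k)%N]/k.+3 /= mulr0 subr0 sub0r.
set A := (X in X = _).
have AE (k l : nat) (i j : 'I_m) : i = k :> nat -> j = l :> nat ->
    A i j = s * (f3V a k * f3V a l)
            + b * ((if (k <= 2 <= k + l)%N then f3V a (k + l - 2)%N else 0)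
                   - (if (3 <= l)%N then f3V a (k + l - 2)%N else 0)).
  move=> <- <-; rewrite -HLE -HXE [LHS]mxE [X in X + _]mxE [X in _ + X]mxE.
  by rewrite [X in s * X]mxE [X in b * X]mxE [X in b * (_ + X)]mxE.
apply/matrixP => i j.
case: (split_ordP i) => i' ->; case: (split_ordP j) => j' ->.
- rewrite block_mxEul (AE i' j') // !mxE big_ord1 !mxE.
  by rewrite [in X in _ - X]leqNgt (ltn_ord j') subr0 -(ltnS i') ltn_ord.
- rewrite block_mxEur (AE i' (3 + j')%N) // !mxE big_ord1 !mxE V3.
  have -> : (i' <= 2 <= i' + (3 + j'))%N by have := ltn_ord i'; lia.
  by rewrite subrr; ring.
- rewrite block_mxEdl (AE (3 + i')%N j') // !mxE big_ord1 !mxE V3.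
  by rewrite [in X in _ - X]leqNgt (ltn_ord j') subr0; ring.
rewrite block_mxEdr (AE (3 + i')%N (3 + j')%N) // !mxE big_ord1 !mxE !V3.
have -> : (3 + i' + (3 + j') - 2 = 3 + (i' + j' + 1))%N by lia.
by rewrite V3 /=; ring.
Qed.

(** The product is the coefficient of z^2 in 1/f, which vanishes. *)
Lemma v3_e3 : v3^T *m e3 = 0.
Proof.
apply/matrixP => i j; rewrite !mxE !big_ord_recl big_ord0 !mxE !coef_f3V /=.
by rewrite /bump /=; ring.
Qed.

Lemma K3_e3 : K3 *m e3 = v3.
Proof.
apply/matrixP => i j; rewrite !mxE !big_ord_recl big_ord0 !mxE /= /bump /=.
by rewrite !mulr0 !add0r addr0 mulr1 leq_addl addnK.
Qed.

(** [K3] is antitriangular with ones on the antidiagonal, so its determinant is -1. The rank one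
    term has no effect because [K3 *m e3 = v3] and [v3^T *m e3 = 0]. *)
Lemma det_block3 s : \det (s *: (v3 *m v3^T) + b *: K3) = - b ^+ 3.
Proof.
rewrite (expand_det_row _ ord0) !big_ord_recl big_ord0 /cofactor.
rewrite !(expand_det_row _ ord0) !big_ord_recl !big_ord0 /cofactor !det_mx11.
rewrite !mxE !big_ord1 !mxE !coef_f3V /= /bump /=.
by ring.
Qed.

Lemma toeplitz_row n : (phi n)^T *m phi n = toeplitz n f *m corner K n *m (toeplitz n f)^T.
Proof.
by rewrite toeplitz_corner; apply/matrixP => i j; rewrite !mxE big_ord1 !mxE.
Qed.

Lemma det_hmxS3 n s :
  \det (hmx (3 + n) s) = - b ^+ (2 * n + 3) * \det (hmx n (s + a)).
Proof.
have V0 : f3V a 0%N = 1 by rewrite coef_f3V /= !mulr0 !subr0.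
have -> : \det (hmx (3 + n) s) =
    \det (toeplitz (3 + n) (f3V a) *m hmx (3 + n) s *m (toeplitz (3 + n) (f3V a))^T).
  by rewrite !det_mulmx det_tr det_toeplitz V0 expr1n mul1r mulr1.
rewrite hmx_conj.
(* Column 2 of the upper blocks is b v3 and clears the upper right block. *)
pose U := block_mx 1%:M (s *: (e3 *m phi n)) 0 1%:M.
have detU : \det U = 1 by rewrite det_ublock !det1 mulr1.
set A := block_mx _ _ _ _; rewrite -[LHS]mulr1 -detU -det_mulmx mulmx_block.
rewrite !mulmx1 !mulmx0 !addr0.
have -> : (s *: (v3 *m v3^T) + b *: K3) *m (s *: (e3 *m phi n))
    + - (s * b) *: (v3 *m phi n) = 0.
  rewrite mulmxDl -!scalemxAl -!scalemxAr -mulmxA [v3^T *m _]mulmxA v3_e3 mul0mx.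
  rewrite mulmx0 [K3 *m _]mulmxA K3_e3 !scaler0 add0r scaleNr !scalerA mulrC.
  by rewrite subrr.
(* Clearing leaves the lower right block intact, again by [v3_e3]. *)
have -> : (- (s * b) *: ((phi n)^T *m v3^T)) *m (s *: (e3 *m phi n)) = 0.
  rewrite -!scalemxAl -!scalemxAr -mulmxA [v3^T *m _]mulmxA v3_e3 mul0mx.
  by rewrite mulmx0 !scaler0.
rewrite add0r det_lblock det_block3 detZ toeplitz_row hankel_f3.
(* Both terms are conjugates by L(f), of s E_00 and of M(a), and s E_00 + M(a) = M(s + a). *)
have -> : s *: (toeplitz n f *m corner K n *m (toeplitz n f)^T)
    + toeplitz n f *m hmx n a *m (toeplitz n f)^T
    = toeplitz n f *m hmx n (s + a) *m (toeplitz n f)^T.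
  rewrite scalemxAl scalemxAr -mulmxDl -mulmxDr; congr (_ *m _ *m _).
  by rewrite /hmx scalerDl addrA.
rewrite !det_mulmx det_tr det_toeplitz f3_0 expr1n mul1r mulr1.
by rewrite mulrA mulNr -exprM -exprD addnC.
Qed.

(** * Iteration of the recursion and initial values *)

Lemma D1_3_S3 n t : D1_3 (n + 3) a b t = - b ^+ (2 * n + 3) * D1_3 n a b (t + a).
Proof. by rewrite !D1_3E addnC det_hmxS3 addrA addrAC. Qed.

Lemma D1_3_mod3 n r t :
  D1_3 (3 * n + r) a b t
  = (-1) ^+ n * b ^+ (3 * n ^ 2 + 2 * n * r) * D1_3 r a b (t + n%:R * a).
Proof.
elim: n t => [|n IHn] t; first by rewrite mul0r addr0 !mul1r.
rewrite (_ : (3 * n.+1 + r = 3 * n + r + 3)%N); last by lia.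
rewrite D1_3_S3 IHn.
(* The exponent is the sum of 2 (3 k + r) + 3 over k < n. *)
rewrite (_ : (3 * n.+1 ^ 2 + 2 * n.+1 * r
  = (2 * (3 * n + r) + 3) + (3 * n ^ 2 + 2 * n * r))%N); last by nia.
rewrite [b ^+ (2 * _ + 3 + _)]exprD (_ : t + a + n%:R * a = t + n.+1%:R * a).
  by rewrite [(-1) ^+ n.+1]exprS; ring.
by rewrite -[n.+1]addn1 natrD; ring.
Qed.

Lemma D1_3_0 t : D1_3 0 a b t = 1.
Proof. exact: det_mx00. Qed.

Lemma D1_3_1 t : D1_3 1 a b t = a + t.
Proof. by rewrite D1_3E det_mx11 !mxE coef_fpsXnM /=; ring. Qed.

Lemma D1_3_2 t : D1_3 2 a b t = (a + t) * b.
Proof.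
rewrite D1_3E (expand_det_row _ ord0) !big_ord_recl big_ord0 /cofactor.
by rewrite !det_mx11 !mxE !coef_fpsXnM /= f3_0; ring.
Qed.

End Recursion.

Theorem theorem6p3 (R : realType) (a b t : R[i]) :
  [/\ forall n : nat,
        D1_3 (3 * n) a b t = (-1) ^+ n * b ^+ (3 * n ^ 2),
      forall n : nat,
        D1_3 (3 * n + 1) a b t
          = (-1) ^+ n * (n.+1%:R * a + t) * b ^+ (3 * n ^ 2 + 2 * n)
    & forall n : nat, (1 <= n)%N ->
        D1_3 (3 * n - 1) a b t
          = (-1) ^+ (n - 1) * (n%:R * a + t) * b ^+ (3 * n ^ 2 - 2 * n)].
Proof.
split=> [n|n|[//|n] _].
- by rewrite -[(3 * n)%N]addn0 D1_3_mod3 D1_3_0 mulr1 muln0 addn0.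
- rewrite D1_3_mod3 D1_3_1 muln1 -[n.+1]addn1 natrD; ring.
(* The last family is residue 2 with n lowered by one; the extra factor b comes from [D1_3_2]. *)
rewrite (_ : (3 * n.+1 - 1 = 3 * n + 2)%N); last by lia.
rewrite D1_3_mod3 D1_3_2.
rewrite (_ : (3 * n.+1 ^ 2 - 2 * n.+1 = (3 * n ^ 2 + 2 * n * 2) + 1)%N); last by nia.
by rewrite [b ^+ (_ + 1)]exprD subn1 -[n.+1]addn1 natrD addn1 /=; ring.
Qed.
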